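(* Assume that for $\alpha\ne\alpha'$ in $\{1,2\}$ there is a constant $M_\alpha>0$ such that, for all $(x,y,t)\in\overline Q_T$ and all real $u_1,u_2\ge0$, $$f_\alpha(x,y,t,0_\alpha,u_{\alpha'})\le0,\qquad f_\alpha(x,y,t,u_\alpha,0_{\alpha'})\ge-M_\alpha,$$ and that $g_\alpha\ge0$ on $\partial Q_T$ and $\psi_\alpha\ge0$ on $\overline\omega$. Let $$\widehat U_\alpha(p,t_m)=\begin{cases}\psi_\alpha(p),&m=0,\\0,&m\ge1,\end{cases}\qquad p\in\overline\Omega^h,\ \alpha=1,2,$$ and let $\widetilde U_\alpha$, $\alpha=1,2$, be the solutions of the linear problems $$(\mathcal L^h_\alpha(p,t_m)+\tau^{-1})\widetilde U_\alpha(p,t_m)=\tau^{-1}\widetilde U_\alpha(p,t_{m-1})+M_\alpha,\quad p\in\Omega^h,\ m\ge1,$$ $$\widetilde U_\alpha(p,t_m)=g_\alpha(p,t_m),\ p\in\partial\Omega^h,\ m\ge1,\qquad \widetilde U_\alpha(p,0)=\psi_\alpha(p),\ p\in\overline\Omega^h.$$ Then $\widehat U$ and $\widetilde U$ are ordered lower and upper solutions (nonincreasing case) of the scheme (NDS).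
   Context: Data: $l_1,l_2,T>0$, $\omega=(0,l_1)\times(0,l_2)$, $Q_T=\omega\times(0,T]$, $\partial Q_T=\partial\omega\times(0,T]$; for $\alpha=1,2$: constants $\varepsilon_\alpha>0$, smooth functions $f_\alpha(x,y,t,u)$, $u=(u_1,u_2)$, $g_\alpha$ on $\partial Q_T$, $\psi_\alpha$ on $\overline\omega$, and smooth nonnegative $v_{\alpha,1},v_{\alpha,2}$ on $\overline Q_T$. Vector inequalities are componentwise. Convention: $f_\alpha(x,y,t,a_\alpha,b_{\alpha'})$ is the value of $f_\alpha$ when $u_\alpha=a_\alpha$ and $u_{\alpha'}=b_{\alpha'}$, where $\alpha'\neq\alpha$; $0_\alpha$ means $u_\alpha=0$. Mesh: $x_i=ih_x$ ($0\le i\le N_x$, $h_x=l_1/N_x$), $y_j=jh_y$ ($0\le j\le N_y$, $h_y=l_2/N_y$), $t_m=m\tau$ ($0\le m\le N_\tau$, $\tau=T/N_\tau$). $\overline\Omega^h$ is the set of all $p=(x_i,y_j)$, $\Omega^h$ the interior ones, $\partial\Omega^h=\overline\Omega^h\setminus\Omega^h$. ''$m\ge1$'' means $1\le m\le N_\tau$. Operator: $\mathcal L^h_\alpha U_\alpha=-\varepsilon_\alpha(D_x^2U_\alpha+D_y^2U_\alpha)+v_{\alpha,1}D_x^1U_\alpha+v_{\alpha,2}D_y^1U_\alpha$, with $D_x^2,D_y^2$ the standard second central differences and $D_x^1,D_y^1$ the backward differences. Scheme (NDS): for $\alpha=1,2$, $m\ge1$, $(\mathcal L^h_\alpha(p,t_m)+\tau^{-1})U_\alpha(p,t_m)+f_\alpha(p,t_m,U)-\tau^{-1}U_\alpha(p,t_{m-1})=0$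 for $p\in\Omega^h$; $U(p,t_m)=g(p,t_m)$ for $p\in\partial\Omega^h$; $U(p,0)=\psi(p)$ for $p\in\overline\Omega^h$. Ordered upper and lower solutions (nonincreasing case): $\widetilde U,\widehat U$ are such if, for all $m\ge1$ and $\alpha\ne\alpha'$: $\widetilde U\ge\widehat U$ on $\overline\Omega^h$; on $\Omega^h$, $(\mathcal L^h_\alpha+\tau^{-1})\widetilde U_\alpha(p,t_m)+f_\alpha(p,t_m,\widetilde U_\alpha,\widehat U_{\alpha'})-\tau^{-1}\widetilde U_\alpha(p,t_{m-1})\ge0$ and $(\mathcal L^h_\alpha+\tau^{-1})\widehat U_\alpha(p,t_m)+f_\alpha(p,t_m,\widehat U_\alpha,\widetilde U_{\alpha'})-\tau^{-1}\widehat U_\alpha(p,t_{m-1})\le0$; $\widehat U\le g\le\widetilde U$ on $\partial\Omega^h$; and $\widehat U(p,0)\le\psi(p)\le\widetilde U(p,0)$ on $\overline\Omega^h$. *)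

(* Defs.v *)
From HB Require Import structures.
From mathcomp Require Import all_boot all_order all_algebra.
From mathcomp Require Import all_classical all_reals all_analysis.
Import Order.TTheory GRing.Theory Num.Theory.
Import numFieldNormedType.Exports.

Set Implicit Arguments.
Unset Strict Implicit.
Unset Printing Implicit Defensive.

Local Open Scope classical_set_scope.
Local Open Scope ring_scope.

(* Read on an open set [U] of a finite-dimensional space, where having
   continuous directional derivatives in every direction up to order [k] is
   being of class C^k; ['D_v F] at a point of [U] only depends on the germ
   of [F] there. *)
Fixpoint class_C (R : realType) (V : normedModType R) (k : nat) (U : set V)
    (F : V -> R) : Prop :=
  (forall z, U z -> {for z, continuous F}) /\
  (if k is k'.+1 then
     forall v : V, (forall z, U z -> derivable (F : V -> R^o) z v) /\
                   class_C k' U ('D_v (F : V -> R^o))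
   else True).

(* Smoothness on a set that need not be open is the existence of a C^oo
   extension to an open neighbourhood. *)
Definition smooth_on (R : realType) (V : normedModType R) (A : set V)
    (f : V -> R) : Prop :=
  exists (U : set V) (F : V -> R),
    [/\ open U, A `<=` U, {in A, F =1 f} & forall k, class_C k U F].

(* The index alpha in {1, 2} is ['I_2]; a point of the plane is a pair (x, y)
   and a space-time point is ((x, y), t).  The functions are total, but
   [standing] and the mesh notions only use them on their domains:
   [v1 a], [v2 a] on the closed cylinder, [f a] on the closed cylinder times
   R^2, [g a] on the lateral boundary and [psi a] on the closed rectangle. *)
Record problem (R : realType) := Problem {
  l1 : R;
  l2 : R;
  T : R;
  eps : 'I_2 -> R;
  v1 : 'I_2 -> R * R * R -> R;
  v2 : 'I_2 -> R * R * R -> R;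
  f : 'I_2 -> R * R * R -> 'rV[R]_2 -> R;
  g : 'I_2 -> R * R * R -> R;
  psi : 'I_2 -> R * R -> R }.

Section Data.
Context {R : realType} (P : problem R).

Definition omega : set (R * R) := `]0, l1 P[ `*` `]0, l2 P[.
Definition omega_bar : set (R * R) := `[0, l1 P] `*` `[0, l2 P].
Definition bdry_omega : set (R * R) := omega_bar `\` omega.
Definition QT_bar : set (R * R * R) := omega_bar `*` `[0, T P].
Definition bdry_QT : set (R * R * R) := bdry_omega `*` `]0, T P].

Record standing : Prop := Standing {
  l1_gt0 : 0 < l1 P;
  l2_gt0 : 0 < l2 P;
  T_gt0 : 0 < T P;
  eps_gt0 : forall a, 0 < eps P a;
  v1_smooth : forall a, smooth_on QT_bar (v1 P a);
  v2_smooth : forall a, smooth_on QT_bar (v2 P a);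
  v1_ge0 : forall a z, QT_bar z -> 0 <= v1 P a z;
  v2_ge0 : forall a z, QT_bar z -> 0 <= v2 P a z;
  f_smooth : forall a,
    smooth_on (QT_bar `*` [set: 'rV[R]_2]) (fun zu => f P a zu.1 zu.2);
  g_smooth : forall a, smooth_on bdry_QT (g P a);
  psi_smooth : forall a, smooth_on omega_bar (psi P a) }.

(* [f_at a z s r] is f_a(z, s_a, r_a'), where a' is the index other than a. *)
Definition f_at (a : 'I_2) (z : R * R * R) (s r : R) : R :=
  f P a z (\row_(b < 2) (if b == a then s else r)).

End Data.

(* A mesh is given by the numbers of its steps [Nx], [Ny] and [Nt]. *)
Record mesh := Mesh { Nx : nat; Ny : nat; Nt : nat }.

Definition valid_mesh (h : mesh) : Prop :=
  [/\ (0 < Nx h)%N, (0 < Ny h)%N & (0 < Nt h)%N].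

(* [U a i j m] is the value U_a(x_i, y_j, t_m); only the values with
   i <= Nx, j <= Ny, m <= Nt are meaningful. *)
Definition mesh_fun (R : realType) := 'I_2 -> nat -> nat -> nat -> R.

Section Scheme.
Context {R : realType} (P : problem R) (h : mesh).
Implicit Types (U : mesh_fun R) (a : 'I_2) (i j m : nat).

Definition hx : R := l1 P / (Nx h)%:R.
Definition hy : R := l2 P / (Ny h)%:R.
Definition tau : R := T P / (Nt h)%:R.

Definition node i j : R * R := (i%:R * hx, j%:R * hy).
Definition stnode i j m : R * R * R := (node i j, m%:R * tau).

Definition closed_mesh i j : bool := (i <= Nx h)%N && (j <= Ny h)%N.
Definition interior_mesh i j : bool := (0 < i < Nx h)%N && (0 < j < Ny h)%N.
Definition boundary_mesh i j : bool :=
  closed_mesh i j && ~~ interior_mesh i j.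

Definition time_level m : bool := (1 <= m <= Nt h)%N.

Definition Dx2 (W : nat -> nat -> R) i j : R :=
  (W i.+1 j - 2 * W i j + W i.-1 j) / hx ^+ 2.
Definition Dy2 (W : nat -> nat -> R) i j : R :=
  (W i j.+1 - 2 * W i j + W i j.-1) / hy ^+ 2.
Definition Dx1 (W : nat -> nat -> R) i j : R := (W i j - W i.-1 j) / hx.
Definition Dy1 (W : nat -> nat -> R) i j : R := (W i j - W i j.-1) / hy.

Definition Lh U a i j m : R :=
  let W := fun i' j' => U a i' j' m in
  - eps P a * (Dx2 W i j + Dy2 W i j)
  + v1 P a (stnode i j m) * Dx1 W i j + v2 P a (stnode i j m) * Dy1 W i j.

Definition Lh_tau U a i j m : R := Lh U a i j m + tau^-1 * U a i j m.

(* Residual of the scheme for the component [a] of [U], with the component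
   other than [a] of [V] in the remaining argument of the reaction term; the
   scheme itself reads [residual U U a a' i j m = 0]. *)
Definition residual U V a a' i j m : R :=
  Lh_tau U a i j m + f_at P a (stnode i j m) (U a i j m) (V a' i j m)
  - tau^-1 * U a i j m.-1.

(* [Ut] is the upper and [Uh] the lower function. *)
Record ordered_upper_lower (Ut Uh : mesh_fun R) : Prop := OrderedUpperLower {
  oul_order : forall a i j m, time_level m -> closed_mesh i j ->
    Uh a i j m <= Ut a i j m;
  oul_upper : forall a a' i j m, a != a' -> time_level m ->
    interior_mesh i j -> 0 <= residual Ut Uh a a' i j m;
  oul_lower : forall a a' i j m, a != a' -> time_level m ->
    interior_mesh i j -> residual Uh Ut a a' i j m <= 0;
  oul_boundary : forall a i j m, time_level m -> boundary_mesh i j ->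
    Uh a i j m <= g P a (stnode i j m) <= Ut a i j m;
  oul_initial : forall a i j, closed_mesh i j ->
    Uh a i j 0%N <= psi P a (node i j) <= Ut a i j 0%N }.

Definition lower_candidate : mesh_fun R :=
  fun a i j m => if m == 0%N then psi P a (node i j) else 0.

Record solves_linear (M : 'I_2 -> R) (U : mesh_fun R) : Prop := SolvesLinear {
  lin_interior : forall a i j m, time_level m -> interior_mesh i j ->
    Lh_tau U a i j m = tau^-1 * U a i j m.-1 + M a;
  lin_boundary : forall a i j m, time_level m -> boundary_mesh i j ->
    U a i j m = g P a (stnode i j m);
  lin_initial : forall a i j, closed_mesh i j ->
    U a i j 0%N = psi P a (node i j) }.

End Scheme.

(* Main.v *)
Require Import Defs.
From mathcomp Require Import all_boot all_order all_algebra.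
From mathcomp Require Import all_classical all_reals all_analysis.
From mathcomp Require Import lra zify.
Import Order.TTheory GRing.Theory Num.Theory.
Local Open Scope classical_set_scope.
Local Open Scope ring_scope.

(** Everything rests on the nonnegativity of the upper candidate.  The
    difference operator, with central second differences and with backward
    first differences against nonnegative velocities, is monotone: at an
    interior minimum over the mesh it is nonpositive ([Lh_le0_at_min]).  Adding
    the positive reaction rate [tau^-1] excludes a negative interior minimum
    ([discrete_maximum_principle]), so induction on the time levels, with the
    nonnegative data [psi], [g] and [M], gives a nonnegative solution of the
    linear problem ([solves_linear_ge0]).

    The ordering of the two candidates is this nonnegativity.  In the upper
    residual the linear equation cancels everything but
    [M a + f_a(z, Ut_a, 0)], which the lower bound on [f_a] makes nonnegative;
    in the lower residual the operator vanishes and there remains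
    [f_a(z, 0, Ut_a')] minus a nonnegative multiple of the previous level,
    which the sign of [f_a(z, 0, .)] makes nonpositive.  Both bounds on [f_a]
    hold only at nonnegative arguments, hence need nonnegativity again. *)

Lemma node_coord_itv {R : realType} {l : R} {N i : nat} :
  0 < l -> (0 < N)%N -> (i <= N)%N -> 0 <= i%:R * (l / N%:R) <= l.
Proof.
move=> l0 N0 iN; have N0' : (0 : R) < N%:R by rewrite ltr0n.
rewrite mulr_ge0 ?ler0n ?divr_ge0 ?(ltW l0) ?(ltW N0') //=.
by rewrite mulrCA ger_pMr // ler_pdivrMr // mul1r ler_nat.
Qed.

Lemma node_coord_oo {R : realType} {l : R} {N i : nat} :
  0 < l -> (0 < N)%N -> (0 < i%:R * (l / N%:R) < l) = (0 < i < N)%N.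
Proof.
move=> l0 N0; have N0' : (0 : R) < N%:R by rewrite ltr0n.
rewrite pmulr_lgt0 ?divr_gt0 // ltr0n; congr (_ && _).
by rewrite mulrCA gtr_pMr // ltr_pdivrMr // mul1r ltr_nat.
Qed.

Section MeshPoints.
Context {R : realType} {P : problem R} {h : mesh}.
Hypotheses (hP : standing P) (hh : valid_mesh h).

Lemma node_omega_bar {i j : nat} :
  closed_mesh h i j -> omega_bar P (node P h i j).
Proof.
case: hh => Nx0 Ny0 _ /andP[iN jN].
split; rewrite /= in_itv /=; apply: node_coord_itv => //.
- exact: l1_gt0 hP.
- exact: l2_gt0 hP.
Qed.

Lemma node_bdry_omega {i j : nat} :
  boundary_mesh h i j -> bdry_omega P (node P h i j).
Proof.
case: hh => Nx0 Ny0 _ /andP[cij nij]; split; first exact: node_omega_bar.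
move=> [/=]; rewrite !in_itv /= /hx /hy.
rewrite !node_coord_oo ?(l1_gt0 hP) ?(l2_gt0 hP) // => iN jN.
by move: nij; rewrite /interior_mesh iN jN.
Qed.

Lemma hx_gt0 : 0 < hx P h.
Proof. by case: hh => N0 _ _; rewrite divr_gt0 ?ltr0n ?(l1_gt0 hP). Qed.

Lemma hy_gt0 : 0 < hy P h.
Proof. by case: hh => _ N0 _; rewrite divr_gt0 ?ltr0n ?(l2_gt0 hP). Qed.

Lemma tau_gt0 : 0 < tau P h.
Proof. by case: hh => _ _ N0; rewrite divr_gt0 ?ltr0n ?(T_gt0 hP). Qed.

Lemma time_itv {m : nat} : time_level h m -> 0 < m%:R * tau P h <= T P.
Proof.
case: hh => _ _ N0 /andP[m0 mN].
rewrite mulr_gt0 ?ltr0n ?tau_gt0 //=.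
by case/andP: (node_coord_itv (T_gt0 hP) N0 mN).
Qed.

Lemma stnode_QT_bar {i j m : nat} :
  time_level h m -> closed_mesh h i j -> QT_bar P (stnode P h i j m).
Proof.
move=> mN cij; split; first exact: node_omega_bar.
by rewrite /= in_itv /=; case/andP: (time_itv mN) => /ltW -> ->.
Qed.

Lemma stnode_bdry_QT {i j m : nat} :
  time_level h m -> boundary_mesh h i j -> bdry_QT P (stnode P h i j m).
Proof.
move=> mN bij; split; first exact: node_bdry_omega.
by rewrite /= in_itv /= time_itv.
Qed.

Lemma interior_closed {i j : nat} :
  interior_mesh h i j -> closed_mesh h i j.
Proof. by rewrite /interior_mesh /closed_mesh; lia. Qed.

(** At a minimum the second differences are nonnegative and the backward
    differences nonpositive; the signs of [eps], [v1] and [v2] turn each term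
    of the operator nonpositive. *)
Lemma Lh_le0_at_min {U : mesh_fun R} {a : 'I_2} {i j m : nat} :
  time_level h m -> interior_mesh h i j ->
  (forall i' j', closed_mesh h i' j' -> U a i j m <= U a i' j' m) ->
  Lh P h U a i j m <= 0.
Proof.
move=> mN iij Umin.
have zQ := stnode_QT_bar mN (interior_closed iij).
have Uw : U a i j m <= U a i.-1 j m.
  by apply: Umin; move: iij; rewrite /interior_mesh /closed_mesh; lia.
have Ue : U a i j m <= U a i.+1 j m.
  by apply: Umin; move: iij; rewrite /interior_mesh /closed_mesh; lia.
have Us : U a i j m <= U a i j.-1 m.
  by apply: Umin; move: iij; rewrite /interior_mesh /closed_mesh; lia.
have Un : U a i j m <= U a i j.+1 m.
  by apply: Umin; move: iij; rewrite /interior_mesh /closed_mesh; lia.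
have d2 : 0 <= eps P a * (Dx2 P h (fun i' j' => U a i' j' m) i j
                          + Dy2 P h (fun i' j' => U a i' j' m) i j).
  rewrite mulr_ge0 ?(ltW (eps_gt0 hP a)) //.
  by rewrite addr_ge0 // divr_ge0 ?sqr_ge0 //; lra.
have dx : v1 P a (stnode P h i j m) * Dx1 P h (fun i' j' => U a i' j' m) i j
    <= 0.
  rewrite mulr_ge0_le0 ?(v1_ge0 hP) //.
  by rewrite /Dx1 ler_pdivrMr ?hx_gt0 // mul0r subr_le0.
have dy : v2 P a (stnode P h i j m) * Dy1 P h (fun i' j' => U a i' j' m) i j
    <= 0.
  rewrite mulr_ge0_le0 ?(v2_ge0 hP) //.
  by rewrite /Dy1 ler_pdivrMr ?hy_gt0 // mul0r subr_le0.
by rewrite /Lh; lra.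
Qed.

(** A negative minimum cannot lie on the boundary, and at an interior one
    [Lh_le0_at_min] would make [Lh_tau] negative. *)
Lemma discrete_maximum_principle {U : mesh_fun R} {a : 'I_2} {m : nat} :
  time_level h m ->
  (forall i j, interior_mesh h i j -> 0 <= Lh_tau P h U a i j m) ->
  (forall i j, boundary_mesh h i j -> 0 <= U a i j m) ->
  forall i j, closed_mesh h i j -> 0 <= U a i j m.
Proof.
move=> mN Uint Ubd i j cij.
pose W (p : 'I_(Nx h).+1 * 'I_(Ny h).+1) := U a p.1 p.2 m.
have [[i0 j0] _ Wmin] := @Order.TotalTheory.arg_minP _ _ _
  (ord0, ord0) xpredT W isT.
have Umin i' j' : closed_mesh h i' j' -> U a i0 j0 m <= U a i' j' m.
  by case/andP=> iN jN; have := Wmin (Ordinal (iN : (i' < (Nx h).+1)%N),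
    Ordinal (jN : (j' < (Ny h).+1)%N)) isT.
apply: le_trans (Umin _ _ cij).
have c0 : closed_mesh h i0 j0 by apply/andP; split; rewrite -ltnS.
have [iij|nij] := boolP (interior_mesh h i0 j0); last first.
  by apply: Ubd; rewrite /boundary_mesh c0.
have := Uint _ _ iij; rewrite /Lh_tau.
have := Lh_le0_at_min mN iij Umin => L0 LU0.
(* Both [Lh <= 0] and [0 <= Lh + tau^-1 * U] hold, so [tau^-1 * U] is nonnegative. *)
rewrite -(pmulr_rge0 (x := (tau P h)^-1)) ?invr_gt0 ?tau_gt0 //.
lra.
Qed.

(** Each time level inherits nonnegativity from the previous one, which is a
    source term of the linear problem. *)
Lemma solves_linear_ge0 {M : 'I_2 -> R} {U : mesh_fun R} :
  (forall a, 0 <= M a) ->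
  (forall a z, bdry_QT P z -> 0 <= g P a z) ->
  (forall a p, omega_bar P p -> 0 <= psi P a p) ->
  solves_linear P h M U ->
  forall a i j m, (m <= Nt h)%N -> closed_mesh h i j -> 0 <= U a i j m.
Proof.
move=> M0 g0 psi0 [Uint Ubd Uini] a i j m; elim: m i j => [|m IH] i j mN cij.
  by rewrite Uini // psi0 //; exact: node_omega_bar.
have tm : time_level h m.+1 by rewrite /time_level mN.
apply: (@discrete_maximum_principle U a m.+1) => // i' j' ij'.
  rewrite Uint // addr_ge0 // mulr_ge0 ?invr_ge0 ?(ltW tau_gt0) //=.
  by apply: IH; [exact: ltnW | exact: interior_closed].
by rewrite Ubd // g0 //; exact: stnode_bdry_QT.
Qed.

Lemma lower_candidate_ge0 :
  (forall a p, omega_bar P p -> 0 <= psi P a p) ->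
  forall a i j m, closed_mesh h i j -> 0 <= lower_candidate P h a i j m.
Proof.
move=> psi0 a i j m cij; rewrite /lower_candidate; case: ifP => // _.
by apply: psi0; exact: node_omega_bar.
Qed.

Lemma lower_candidate_pos (a : 'I_2) {i j m : nat} :
  time_level h m -> lower_candidate P h a i j m = 0.
Proof. by case: m. Qed.

Lemma Lh_tau_lower_candidate (a : 'I_2) {i j m : nat} :
  time_level h m -> Lh_tau P h (lower_candidate P h) a i j m = 0.
Proof.
move=> mN; rewrite /Lh_tau /Lh /Dx2 /Dy2 /Dx1 /Dy1 !lower_candidate_pos //.
by rewrite !(mulr0, subr0, addr0, mul0r).
Qed.

End MeshPoints.

Theorem theorem15 (R : realType) (P : problem R) (h : mesh) (M : 'I_2 -> R)
    (Ut : mesh_fun R)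
    (hP : standing P) (hh : valid_mesh h)
    (hM : forall a, 0 < M a)
    (hf : forall (a a' : 'I_2), a != a' ->
      forall z, QT_bar P z ->
      forall u : 'I_2 -> R, (forall b, 0 <= u b) ->
        f_at P a z 0 (u a') <= 0 /\ - M a <= f_at P a z (u a) 0)
    (hg : forall a z, bdry_QT P z -> 0 <= g P a z)
    (hpsi : forall a p, omega_bar P p -> 0 <= psi P a p)
    (hUt : solves_linear P h M Ut) :
  ordered_upper_lower P h Ut (lower_candidate P h).
Proof.
have Ut0 a i j m : time_level h m -> closed_mesh h i j -> 0 <= Ut a i j m.
  case/andP=> _ mN.
  exact: (solves_linear_ge0 hP hh (fun a => ltW (hM a)) hg hpsi hUt).
split.
- by move=> a i j m mN cij; rewrite lower_candidate_pos // Ut0.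
- move=> a a' i j m aa' mN iij; have cij := interior_closed iij.
  rewrite /residual (lin_interior hUt) // lower_candidate_pos //.
  have [_] := hf a a' aa' _ (stnode_QT_bar hP hh mN cij)
    (fun b => Ut b i j m) (fun b => Ut0 b i j m mN cij).
  lra.
- move=> a a' i j m aa' mN iij; have cij := interior_closed iij.
  rewrite /residual Lh_tau_lower_candidate // lower_candidate_pos // add0r.
  have [f0 _] := hf a a' aa' _ (stnode_QT_bar hP hh mN cij)
    (fun b => Ut b i j m) (fun b => Ut0 b i j m mN cij).
  rewrite subr_le0 (le_trans f0) // mulr_ge0 ?invr_ge0 //.
    exact: ltW (tau_gt0 hP hh).
  exact: (lower_candidate_ge0 hP hh).
- move=> a i j m mN bij; rewrite lower_candidate_pos // (lin_boundary hUt) //.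
  by rewrite lexx andbT hg //; exact: (stnode_bdry_QT hP hh).
- by move=> a i j cij; rewrite (lin_initial hUt) // lexx.
Qed.
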